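(* Let $X$ be a proper metric space and let $n\ge 0$ be an integer. Then the following conditions are equivalent: (a) $\dim(\nu(X))\le n$, where $\dim$ is the covering dimension and $\nu(X)$ is the Higson corona of $X$; (b) $S^n$ is a large scale absolute extensor of $X$.
   Context: A metric space is proper if its bounded subsets have compact closure. A function $f\colon X\to Y$ of metric spaces (not assumed continuous) is slowly oscillating if, for a base point $x_0\in X$ (whose choice is irrelevant), for all $R,\epsilon>0$ there is $N>0$ such that for every $x\in X$ with $d(x_0,x)>N$ the diameter of $f(B(x,R))$ is less than $\epsilon$. The Higson compactification $h(X)$ of a proper metric space $X$ is the compactification of $X$ characterized by: a continuous function $f\colon X\to[0,1]$ extends continuously to $h(X)$ if and only if $f$ is slowly oscillating (equivalently, it is the closure of the image of $X$ in the product of copies of $[0,1]$ indexed by all continuous slowly oscillating functions $X\to[0,1]$). The Higson corona is $\nu(X)=h(X)\setminus X$ (empty if $X$ is compact). A metric space $K$ is a large scale absolute extensor of a metric space $X$ if for every subset $A\subset X$ and every slowly oscillating (not necessarily continuous) $f\colon A\to K$ there is a slowly oscillating $g\colon X\to K$ with $g|_A=f$. $S^n$ denotes the boundary $\partial\Delta^{n+1}$ of the standard unit $(n+1)$-simplex with the $\ell_1$-metric (bi-Lipschitz equivalent to the unit sphere of $\mathbb R^{n+1}$). *)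

(* Defs.v *)
From HB Require Import structures.
From mathcomp Require Import all_boot all_order all_algebra.
From mathcomp Require Import all_classical all_reals all_analysis.

Set Implicit Arguments.
Unset Strict Implicit.
Unset Printing Implicit Defensive.

Import Order.TTheory GRing.Theory Num.Theory.
Import numFieldTopology.Exports.

Local Open Scope classical_set_scope.
Local Open Scope ring_scope.

(* [set_type A] already carries the pseudometric induced by the inclusion; this
   makes it a metric space with the restricted distance. *)
Section subset_metric.
Context {R : realType} {X : metricType R} (A : set X).

Let sub_dist (x y : A) : R := mdist (set_val x) (set_val y).

Let sub_dist_ge0 x y : 0 <= sub_dist x y.
Proof. exact: mdist_ge0. Qed.

Let sub_dist_positivity x y : sub_dist x y = 0 -> x = y.
Proof. by move=> /mdist_positivity /val_inj. Qed.

Let ball_sub_dist (x : A) (d : R) : ball x d = [set y | sub_dist x y < d].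
Proof. by rewrite {1}/ball /= /initial_ball ballEmdist. Qed.

HB.instance Definition _ := @PseudoMetric_isMetric.Build R (set_type A)
  sub_dist sub_dist_ge0 sub_dist_positivity ball_sub_dist.

End subset_metric.

(* The diameter is only ever compared with an upper bound, so that the value
   -oo on the empty set is harmless. *)
Definition diam {R : realType} {X : metricType R} (A : set X) : \bar R :=
  ereal_sup [set (mdist p.1 p.2)%:E | p in A `*` A].

Definition proper_metric {R : realType} (X : metricType R) : Prop :=
  forall A : set X, (diam A < +oo)%E -> compact (closure A).

(* Quantifying over all base points makes sense for the empty space, too. *)
Definition slowly_oscillating {R : realType} {X Y : metricType R}
    (f : X -> Y) : Prop :=
  forall (x0 : X) (r e : R), 0 < r -> 0 < e ->
    exists2 N : R, 0 < N &
      forall x : X, N < mdist x0 x -> (diam (f @` ball x r) < e%:E)%E.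

Definition large_scale_absolute_extensor {R : realType}
    (K X : metricType R) : Prop :=
  forall (A : set X) (f : A -> K), slowly_oscillating f ->
    exists2 g : X -> K, slowly_oscillating g & forall a : A, g (set_val a) = f a.

Definition unit_interval (R : realType) : set R^o := [set t | 0 <= t <= 1].
Arguments unit_interval R : clear implicits.

Definition higson_functions {R : realType} (X : metricType R) :
  set (X -> unit_interval R) := [set f | continuous f /\ slowly_oscillating f].
Arguments higson_functions {R} X.

Definition higson_cube {R : realType} (X : metricType R) : topologicalType :=
  prod_topology (fun _ : higson_functions X => unit_interval R).

Definition higson_eval {R : realType} (X : metricType R) (x : X) :
  higson_cube X := fun f => set_val f x.

Definition higson_compactification {R : realType} (X : metricType R) :
  set (higson_cube X) := closure (range (@higson_eval R X)).
Arguments higson_compactification {R} X.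

Definition higson_corona {R : realType} (X : metricType R) :
  set (higson_cube X) :=
  higson_compactification X `\` range (@higson_eval R X).
Arguments higson_corona {R} X.

(* dim T <= n: every finite open cover has a finite open refinement of order
   at most n, i.e. no point lies in more than n + 1 of its members. *)
Definition covering_dim_le (T : topologicalType) (n : nat) : Prop :=
  forall U : set (set T),
    finite_set U -> U `<=` open -> \bigcup_(A in U) A = setT ->
    exists V : set (set T),
      [/\ finite_set V, V `<=` open, \bigcup_(B in V) B = setT,
          forall B, V B -> exists2 A, U A & B `<=` A &
          forall x : T, ([set B | V B /\ B x] #<= `I_n.+1)%card].

Definition l1_space (R : realType) (m : nat) : Type := {ffun 'I_m -> R}.

Section l1_metric.
Context (R : realType) (m : nat).

HB.instance Definition _ := Choice.on (l1_space R m).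

Let l1_dist (x y : l1_space R m) : R := \sum_i `|x i - y i|.

Let l1_distxx x : l1_dist x x = 0.
Proof. by rewrite /l1_dist big1// => i _; rewrite subrr normr0. Qed.

Let l1_dist_positivity x y : l1_dist x y = 0 -> x = y.
Proof.
move=> /eqP; rewrite psumr_eq0// => /allP xy; apply/ffunP => i.
by have := xy i (mem_index_enum i); rewrite normr_eq0 subr_eq0 => /eqP.
Qed.

Let l1_dist_sym x y : l1_dist x y = l1_dist y x.
Proof. by apply: eq_bigr => i _; exact: distrC. Qed.

Let l1_dist_triangle y x z : l1_dist x z <= l1_dist x y + l1_dist y z.
Proof. by rewrite -big_split; apply: ler_sum => i _; exact: ler_distD. Qed.

HB.instance Definition _ := @isMetric.Build R (l1_space R m)
  l1_dist l1_distxx l1_dist_positivity l1_dist_sym l1_dist_triangle.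

End l1_metric.

Definition standard_simplex (R : realType) (k : nat) :
  set (l1_space R k.+1) := [set t | (forall i, 0 <= t i) /\ \sum_i t i = 1].
Arguments standard_simplex R k : clear implicits.

(* The boundary is the union of the proper faces: some barycentric coordinate
   vanishes. *)
Definition simplex_boundary (R : realType) (k : nat) :
  set (l1_space R k.+1) :=
  standard_simplex R k `&` [set t | exists i, t i = 0].
Arguments simplex_boundary R k : clear implicits.

Definition simplex_sphere (R : realType) (n : nat) : metricType R :=
  set_type (simplex_boundary R n.+1).

(* Main.v *)
(* Both conditions are equivalent to a coarse covering property of [X], for
   m = n + 2. Call D_1, ..., D_m coarsely disjoint if, for every r, the
   intersection of their r-neighbourhoods is bounded. The property says that
   every coarsely disjoint family can be enlarged, up to bounded sets, to a
   coarsely disjoint family that covers [X].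

   For (a): by Hemmingsen's theorem, dim <= n means that every open cover of the
   corona by m sets shrinks to one with empty intersection. Pass to complements
   and thicken the closed sets in the Higson cube. A family D_i is coarsely
   disjoint iff the sets of limit points of the D_i in the corona have empty
   intersection: one direction uses the slowly oscillating functions
   d(x, D_i) / max(1, sum_j d(x, D_j)), the other moves limit points along maps
   at bounded distance from the identity.

   For (b): the same functions map the union of the D_i to the boundary of the
   simplex, and the zero sets of the coordinates of an extension enlarge the
   D_i. Conversely, a map f from A to the boundary has a slowly oscillating
   extension F to [0,1]^m by a Tietze theorem; enlarging the sets where F_i is
   small and sum F is nearly 1 gives a map of [X] to the boundary that can be
   interpolated with F. *)
Require Import Defs.
From mathcomp Require Import all_boot all_order all_algebra.
From mathcomp Require Import all_classical all_reals all_analysis.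
From mathcomp Require Import ring lra.

Set Implicit Arguments.
Unset Strict Implicit.
Unset Printing Implicit Defensive.

Import Order.TTheory GRing.Theory Num.Theory.
Import numFieldTopology.Exports.

Local Open Scope classical_set_scope.
Local Open Scope ring_scope.

(** * Covering dimension as shrinkability of covers *)

Definition shrinkable_covers (T : topologicalType) (m : nat) : Prop :=
  forall U : 'I_m -> set T,
    (forall i, open (U i)) -> (forall x, exists i, U i x) ->
    exists V : 'I_m -> set T,
      [/\ forall i, open (V i), forall i, V i `<=` U i,
          forall x, exists i, V i x & forall x, ~ forall i, V i x].

(** The members of a refinement are grouped by a member of the cover that contains them. A point in
    all [n.+2] groups would lie in [n.+2] distinct members of the refinement. *)
Lemma covering_dim_shrinkable (T : topologicalType) (n : nat) :
  covering_dim_le T n -> shrinkable_covers T n.+2.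
Proof.
move=> dimT U oU coverU.
have [||V [_ oV coverV refV ordV]] := dimT (range U) (finite_image _ finite_finset).
- by move=> _ [i _ <-]; exact: oU.
- by apply/seteqP; split=> // x _; have [i] := coverU x; exists (U i) => //; exists i.
have /choice[ind indP] : forall B, exists i, V B -> B `<=` U i.
  move=> B; have [VB|nVB] := pselect (V B); last by exists ord0.
  by have [_ [i _ <-] BU] := refV B VB; exists i.
exists (fun i => \bigcup_(B in [set B | V B /\ ind B = i]) B); split.
- by move=> i; apply: bigcup_open => B [/oV].
- by move=> i x [B [VB <-]]; exact: indP.
- move=> x; have : [set: T] x by [].
  by rewrite -coverV => -[B VB Bx]; exists (ind B), B.
- move=> x allx.
  have /choice[b bP] : forall i, exists B, [/\ V B, ind B = i & B x].
    by move=> i; have [B [VB iB] Bx] := allx i; exists B.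
  have b_inj : {in `I_n.+2 &, injective (b \o inord)}.
    move=> i j /set_mem /= ilt /set_mem /= jlt bij.
    rewrite -[i](@inordK n.+1)// -[j](@inordK n.+1)//.
    by have [_ <- _] := bP (inord i); have [_ <- _] := bP (inord j); rewrite bij.
  have : (`I_n.+2 #<= `I_n.+1)%card.
    apply: card_le_trans (ordV x).
    rewrite -(card_le_eql (inj_card_eq b_inj)).
    by apply: subset_card_le => _ [i _ <-]; have [] := bP (inord i).
  by rewrite card_le_II ltnn.
Qed.

(* A cover is shrunk successively, once for every way [rho] of grouping its
   members into [n.+2] classes: a point lying in [n.+2] members would survive
   the shrinking for a grouping that separates them. *)
Lemma shrinkable_groupings (T : topologicalType) (n k : nat)
    (U : 'I_k -> set T) (s : seq {ffun 'I_k -> 'I_n.+2}) :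
  shrinkable_covers T n.+2 ->
  (forall j, open (U j)) -> (forall x, exists j, U j x) ->
  exists V : 'I_k -> set T,
    [/\ forall j, open (V j), forall j, V j `<=` U j,
        forall x, exists j, V j x &
        forall rho x, rho \in s -> ~ forall i, exists2 j, rho j = i & V j x].
Proof.
move=> shrT oU coverU; elim: s => [|rho s [V [oV VU coverV sepV]]].
  by exists U; split=> // j x.
have [||W [oW WV coverW sepW]] :=
    shrT (fun i => \bigcup_(j in [set j | rho j = i]) V j).
- by move=> i; apply: bigcup_open => j _.
- by move=> x; have [j Vjx] := coverV x; exists (rho j), j.
exists (fun j => V j `&` W (rho j)); split.
- by move=> j; exact: openI.
- by move=> j x [/VU].
- by move=> x; have [i Wix] := coverW x; have [j rhoj Vj] := WV i x Wix;
    exists j; rewrite rhoj.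
- move=> sigma x; rewrite in_cons => /predU1P[->|sig_s] allx.
    by apply: (sepW x) => i; have [j <- []] := allx i.
  by apply: (sepV sigma x sig_s) => i; have [j ji []] := allx i; exists j.
Qed.

Lemma shrinkable_covering_dim (T : topologicalType) (n : nat) :
  shrinkable_covers T n.+2 -> covering_dim_le T n.
Proof.
move=> shrT U /finite_setP[k /card_esym/card_set_bijP[f bijf]] oU coverU.
have fU (j : 'I_k) : U (f j) by apply: (set_bij_sub bijf); exists (j : nat) => //=.
have [||V [oV VU coverV sepV]] := @shrinkable_groupings T n k
    (fun j => f j) (enum {ffun 'I_k -> 'I_n.+2}) shrT.
- by move=> j; exact/oU/fU.
- move=> x; have : [set: T] x by [].
  rewrite -coverU => -[B UB Bx].
  by have [j jk fj] := set_bij_surj bijf UB; exists (Ordinal jk); rewrite /= fj.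
exists (range V); split.
- exact: finite_image finite_finset.
- by move=> _ [j _ <-].
- apply/seteqP; split=> // x _; have [j Vjx] := coverV x.
  by exists (V j) => //; exists j.
- by move=> _ [j _ <-]; exists (f j) => //; exact: VU.
move=> x; pose J := [set j : 'I_k | `[< V j x >]]%SET.
have leJ : (#|J| <= n.+1)%N.
  rewrite leqNgt; apply/negP => ltJ.
  (* This grouping numbers the members that contain [x], so the first [n.+2] of them fall into
     different classes. All other indices take the default value of [inord], which does no harm. *)
  pose rho := [ffun j => inord (index j (enum J)) : 'I_n.+2].
  apply: (sepV rho x); first by rewrite mem_enum.
  move=> i; have iJ : (i < #|J|)%N by exact: leq_trans (ltn_ord i) ltJ.
  exists (enum_val (Ordinal iJ)).
    rewrite ffunE (enum_val_nth (enum_val (Ordinal iJ))) index_uniq ?inord_val//.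
      by rewrite -cardE.
    exact: enum_uniq.
  by have := enum_valP (Ordinal iJ); rewrite inE => /asboolP.
apply: (@card_le_trans _ _ _ `I_#|J|); last by rewrite card_le_II.
apply: (card_le_trans _ (card_image_le
  (fun i => if insub i is Some i' then V (enum_val (i' : 'I_#|J|)) else set0) _)).
apply: subset_card_le => _ [[j _ <-] Vjx].
have jJ : j \in J by rewrite inE; exact/asboolP.
exists (enum_rank_in jJ j : nat) => /=; first exact: ltn_ord.
by rewrite valK enum_rankK_in.
Qed.

(** The sets are thickened one at a time: [N i] lies in the open complement of the intersection of
    the others, and normality puts a closed neighbourhood of [N i] in between. *)
Lemma closed_thickening (T : topologicalType) (m : nat) (E : 'I_m -> set T) :
  normal_space T -> (forall i, closed (E i)) -> (forall x, ~ forall i, E i x) ->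
  exists N : 'I_m -> set T,
    [/\ forall i, closed (N i), forall i, E i `<=` (N i)° &
        forall x, ~ forall i, N i x].
Proof.
move=> normT cE E0.
suff [N [cN _ EN N0]] : exists N : 'I_m -> set T,
    [/\ forall i, closed (N i), forall i, E i `<=` N i,
        forall i, i \in enum 'I_m -> E i `<=` (N i)° & forall x, ~ forall i, N i x].
  by exists N; split=> // i; apply: EN; rewrite mem_enum.
elim: (enum 'I_m) => [|i s [N [cN EN ENs N0]]].
  by exists E; split=> // i x.
pose C := ~` (\bigcap_(j in [set j | j != i]) N j).
have oC : open C.
  by apply: closed_openC; apply: closed_bigI => j _; exact: cN.
have [|B nB BC] := normT (N i) (cN i) C.
  move=> x Nix; apply: open_nbhs_nbhs; split=> // allx; apply: (N0 x) => j.
  by have [->//|ji] := eqVneq j i; exact: allx.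
exists (fun j => if j == i then closure B else N j); split.
- by move=> j; case: ifP => _; [exact: closed_closure|exact: cN].
- move=> j x Ejx; case: ifP => [/eqP ji|_]; last exact: EN.
  by apply: subset_closure; apply: nbhs_singleton; apply: nB; apply: EN; rewrite -ji.
- move=> j js x Ejx; case: ifP => [/eqP ji|/negbT ji]; last first.
    by apply: (ENs j) => //; move: js; rewrite in_cons (negbTE ji).
  have /nB : N i x by apply: EN; rewrite -ji.
  by apply: filterS; exact: subset_closure.
- move=> x allx; have := allx i; rewrite eqxx => /BC; apply => j /= ji.
  by have := allx j; rewrite (negbTE ji).
Qed.

(** * Limit points along a filter *)

Definition limit_set {X : Type} {T : topologicalType} (F : set_system X)
  (phi : X -> T) (B : set X) : set T := cluster (phi @ within B F).

Section limit_sets.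
Context {X : Type} {T : topologicalType} {F : set_system X} {FF : Filter F}.
Variable phi : X -> T.
Local Notation lim_set := (limit_set F phi).

Lemma limit_setP (B : set X) (p : T) : lim_set B p <->
  forall A W, F A -> nbhs p W -> exists x, [/\ A x, B x & W (phi x)].
Proof.
split=> [clp A W FA pW|clp A W FA pW].
  have [|_ [[x [Ax Bx] <-] Wx]] := clp (phi @` (A `&` B)) W _ pW; last by exists x.
  by apply: filterS FA => x Ax Bx; exists x.
by have [x [Ax Bx Wx]] := clp _ _ FA pW; exists (phi x); split=> //; exact: Ax.
Qed.

Lemma limit_set_closed (B : set X) : closed (lim_set B).
Proof. by rewrite /limit_set clusterE; apply: closed_bigI => A _; exact: closed_closure. Qed.

Lemma limit_set_near_sub (B C : set X) :
  (\forall x \near F, B x -> C x) -> lim_set B `<=` lim_set C.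
Proof.
move=> BC p /limit_setP clp; apply/limit_setP => A W FA pW.
by have [x [[Ax BCx] Bx Wx]] := clp _ _ (filterI FA BC) pW; exists x; split=> //; exact: BCx.
Qed.

Lemma limit_set_nonempty (B : set X) : compact [set: T] ->
  ~ F (~` B) -> lim_set B !=set0.
Proof.
move=> cT nFB.
have PF : ProperFilter (phi @ within B F).
  apply: fmap_proper_filter; split; last exact: within_filter.
  by move=> FB0; apply: nFB; exact: FB0.
by have [|p [_ clp]] := cT _ PF; [exact: filterT|exists p].
Qed.

Lemma limit_set_cover (m : nat) (D : 'I_m -> set X) :
  (\forall x \near F, exists i, D i x) ->
  forall p, lim_set setT p -> exists i, lim_set (D i) p.
Proof.
move=> cover p /limit_setP clp; apply: contrapT => /forallNP nD.
have /choice[AW AWP] : forall i, exists AW : set X * set T,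
    [/\ F AW.1, nbhs p AW.2 & forall x, AW.1 x -> D i x -> ~ AW.2 (phi x)].
  move=> i; apply: contrapT => nAW; apply: (nD i); apply/limit_setP => A W FA pW.
  apply: contrapT => nx; apply: nAW; exists (A, W); split=> // x Ax Dx Wx.
  by apply: nx; exists x.
have FA : \forall x \near F, forall i, (AW i).1 x.
  by apply: filter_forall => i; have [] := AWP i.
have pW : \forall q \near p, forall i, (AW i).2 q.
  by apply: filter_forall => i; have [] := AWP i.
have [x [[Ax [i Dix]] _ Wx]] := clp _ _ (filterI FA cover) pW.
by have [_ _ /(_ x (Ax i) Dix)] := AWP i; apply; exact: Wx.
Qed.

Lemma limit_set_preimage (N : set T) : closed N -> lim_set (phi @^-1` N) `<=` N.
Proof.
move=> cN p /limit_setP clp; apply: cN => W pW.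
by have [x [_ Nx Wx]] := clp _ _ filterT pW; exists (phi x).
Qed.

Lemma limit_set_nbhs (N : set T) (p : T) :
  lim_set setT p -> nbhs p N -> lim_set (phi @^-1` N) p.
Proof.
move=> /limit_setP clp pN; apply/limit_setP => A W FA pW.
by have [x [Ax _ [Nx Wx]]] := clp _ _ FA (filterI pN pW); exists x.
Qed.

(** If points of [B] were frequently sent outside [N], they would have a limit point by compactness.
    It would lie in the interior of [N], a neighbourhood that they avoid. *)
Lemma limit_set_near_preimage (N : set T) (B : set X) : compact [set: T] ->
  lim_set B `<=` N° -> \forall x \near F, B x -> N (phi x).
Proof.
move=> cT BN; apply: contrapT => nBN.
have [|p clp] := @limit_set_nonempty (B `&` ~` (phi @^-1` N)) cT.
  by move=> FB; apply: nBN; apply: filterS FB => x nx Bx; apply: contrapT => nN; exact: nx.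
have /BN : lim_set B p.
  by apply: limit_set_near_sub clp; apply: nearW => x [].
move=> pN; have /limit_setP/(_ _ _ filterT pN)[x [_ [_ nN] Nx]] := clp.
exact: nN.
Qed.

End limit_sets.

(* The limit points of [Q] are limits along filters on [X], which are moved to
   [D] by [tau] without changing the limit of any coordinate. *)
Lemma limit_set_perturb {R : realType} {X : Type} {I : Type} {K : metricType R}
    {F : set_system X} {FF : Filter F} (phi : X -> prod_topology (fun _ : I => K))
    (tau : X -> X) (Q D : set X) :
  (forall A, F A -> F (tau @^-1` A)) -> (forall x, Q x -> D (tau x)) ->
  (forall i (e : R), 0 < e ->
    \forall x \near F, Q x -> mdist (phi x i) (phi (tau x) i) < e) ->
  limit_set F phi Q `<=` limit_set F phi D.
Proof.
move=> Ftau QD close p /limit_setP clp.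
(* [G] refines [F], contains [Q] and makes [phi] converge to [p]; it is proper because [p] is a
   limit point of [Q]. *)
pose G := filter_from [set AW : set X * set (prod_topology (fun _ : I => K)) |
    F AW.1 /\ nbhs p AW.2]
  (fun AW => AW.1 `&` Q `&` phi @^-1` AW.2).
have GP : ProperFilter G.
  apply: filter_from_proper; last first.
    by move=> [A W] [/= FA pW]; have [x [Ax Qx Wx]] := clp _ _ FA pW; exists x.
  apply: filter_from_filter; first by exists (setT, setT); split; exact: filterT.
  move=> [A W] [A' W'] [/= FA pW] [/= FA' pW'].
  exists (A `&` A', W `&` W'); first by split; exact: filterI.
  by move=> x [[[Ax A'x] Qx] [Wx W'x]].
have GFil : Filter G by case: GP.
have GF A : F A -> G A.
  by move=> FA; exists (A, setT) => [|x [[]]//]; split=> //; exact: filterT.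
have GQ : G Q by exists (setT, setT) => [|x [[]]//]; split; exact: filterT.
have Gp : phi @ G --> p.
  by move=> W pW; exists (setT, W) => [|x []//]; split=> //; exact: filterT.
have Gtau : (phi \o tau) @ G --> p.
  apply/cvg_sup => i.
  move=> W /= [_ [[V oV <-] Vpi] VW].
  have /nbhs_ballP[e /= e0 eV] : nbhs (p i) V by exact: open_nbhs_nbhs.
  have e20 : 0 < e / 2 by rewrite divr_gt0.
  have phii : (fun x => phi x i) @ G --> p i.
    move=> S pS; apply: (Gp [set q | S (q i)]).
    exact: (@proj_continuous {classic I} (fun _ => K) i p S pS).
  have Gclose := @filterI _ _ GFil _ _
    (@filterI _ _ GFil _ _ (GF _ (close i _ e20)) GQ) (phii _ (nbhsx_ballx (p i) _ e20)).
  change (G [set x | W (phi (tau x))]).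
  apply: (@filterS _ G GFil _ _ _ Gclose) => x [[cx Qx] bx]; apply: VW; apply: eV => /=.
  apply: ball_splitr (ball_sym bx) _ => //.
  by rewrite ballEmdist /=; exact: cx.
apply/limit_setP => A W FA pW.
have GA := GF _ (Ftau _ FA).
have [x [[Ax Qx] Wx]] := filter_ex (filterI (filterI GA GQ) (Gtau _ pW)).
by exists (tau x); split=> //; exact: QD.
Qed.

(** * Neighbourhoods of infinity and slow oscillation *)

Section at_infinity.
Context {R : realType} {X : metricType R}.
Implicit Types (x y z : X) (A B : set X).

(** Its members are the sets with bounded complement; on a bounded space it is improper. *)
Definition at_infty (x0 : X) : set_system X :=
  [set P | exists N : R, forall x, N < mdist x0 x -> P x].

Global Instance at_infty_filter x0 : Filter (at_infty x0).
Proof.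
split; first by exists 0.
- move=> P Q [N NP] [M MQ]; exists (Num.max N M) => x.
  by rewrite gt_max => /andP[/NP Px /MQ Qx].
- by move=> P Q PQ [N NP]; exists N => x /NP /PQ.
Qed.

Lemma at_infty_far x0 (N : R) : \forall x \near at_infty x0, N < mdist x0 x.
Proof. by exists N. Qed.

Lemma at_infty_ball x0 (r : R) (P : set X) : (\forall x \near at_infty x0, P x) ->
  \forall x \near at_infty x0, forall y, mdist x y < r -> P y.
Proof.
move=> [N NP]; exists (N + r) => x Nx y xy; apply: NP.
by have := metric_triangle x0 y x; rewrite (metric_sym y x); lra.
Qed.

Lemma at_infty_base x0 x1 : at_infty x0 `<=` at_infty x1.
Proof.
move=> P [N NP]; exists (N + mdist x0 x1) => x Nx; apply: NP.
by have := metric_triangle x1 x0 x; rewrite (metric_sym x1 x0); lra.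
Qed.

(** Stated for functions on all of [X], so that maps on a subset and their extensions are handled
    without subtypes. *)
Definition slow_on (x0 : X) (A : set X) (h : X -> R) : Prop :=
  forall r e : R, 0 < e -> \forall x \near at_infty x0,
    forall y, A x -> A y -> mdist x y < r -> `|h x - h y| < e.

(** Used for formulas built from slowly oscillating functions. As only far points matter, the
    Lipschitz estimate is asked for on [B] alone. *)
Lemma slow_on_lipschitz (I : finType) x0 A (B : set X) (h : I -> X -> R)
    (k : X -> R) (C : R) :
  (forall i, slow_on x0 A (h i)) -> (\forall x \near at_infty x0, B x) ->
  (forall x y, A x -> A y -> B x -> B y ->
    `|k x - k y| <= C * \sum_i `|h i x - h i y|) ->
  slow_on x0 A k.
Proof.
move=> sh farB lip r e e0.
pose d := e / ((`|C| + 1) * (#|I|%:R + 1)).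
have C1 : 0 < `|C| + 1 by have := normr_ge0 C; lra.
have I1 : 0 < #|I|%:R + 1 :> R by have : 0 <= #|I|%:R :> R by []; lra.
have d0 : 0 < d by rewrite divr_gt0// mulr_gt0.
have sh' : \forall x \near at_infty x0, forall i y, A x -> A y -> mdist x y < r ->
    `|h i x - h i y| < d.
  by apply: filter_forall => i; exact: sh.
apply: filterS3 sh' farB (at_infty_ball r farB) => x hx Bx ballB y Ax Ay xy.
apply: le_lt_trans (lip _ _ Ax Ay Bx (ballB _ xy)) _.
set S := \sum_i _; have S0 : 0 <= S by exact: sumr_ge0.
have SI : S <= #|I|%:R * d.
  by rewrite mulr_natl -sumr_const; apply: ler_sum => i _; apply: ltW; exact: hx.
have Sd : S < (#|I|%:R + 1) * d by rewrite mulrDl mul1r; lra.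
have -> : e = (`|C| + 1) * ((#|I|%:R + 1) * d).
  by rewrite /d; field; rewrite !gt_eqF.
apply: (@le_lt_trans _ _ ((`|C| + 1) * S)); last by rewrite ltr_pM2l.
by apply: ler_wpM2r => //; have := ler_norm C; lra.
Qed.

(** The local Lipschitz constant of [k] at [x] is of order [C / s x], which tends to 0 at
    infinity. *)
Lemma slow_on_decay x0 A (k s : X -> R) (C : R) :
  (forall M, \forall x \near at_infty x0, M <= s x) ->
  (forall x y, A x -> A y -> `|k x - k y| * s x <= C * mdist x y) ->
  slow_on x0 A k.
Proof.
move=> sinf decay r e e0.
apply: filterS2 (sinf 1) (sinf ((`|C| * `|r| + 1) / e)) => x s1 sx y Ax Ay xy.
have s0 : 0 < s x by exact: lt_le_trans s1.
rewrite -(ltr_pM2r s0); apply: le_lt_trans (decay x y Ax Ay) _.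
rewrite ler_pdivrMr// in sx; apply: (@lt_le_trans _ _ (`|C| * `|r| + 1)); last by rewrite (mulrC e).
apply: (@le_lt_trans _ _ (`|C| * `|r|)); last by lra.
apply: le_trans (ler_norm _) _; rewrite normrM; apply: ler_wpM2l => //.
by rewrite (ger0_norm (mdist_ge0 _ _)); exact: (le_trans (ltW xy) (ler_norm _)).
Qed.

End at_infinity.

Lemma slowly_oscillatingP {R : realType} {X K : metricType R} (x0 : X) (f : X -> K) :
  slowly_oscillating f <-> (forall r e : R, 0 < e ->
    \forall x \near at_infty x0, forall y, mdist x y < r -> mdist (f x) (f y) < e).
Proof.
split=> [sf r e e0|sf x1 r e r0 e0].
  have [|N N0 fN] := sf x0 (`|r| + 1) e _ e0; first by have := normr_ge0 r; lra.
  exists N => x Nx y xy; rewrite -lte_fin; apply: le_lt_trans (fN x Nx).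
  apply: ereal_sup_ubound; exists (f x, f y) => //; split.
    by exists x => //; apply: ballxx; have := normr_ge0 r; lra.
  by exists y => //; rewrite ballEmdist /=; have := ler_norm r; lra.
have e40 : 0 < e / 4 by lra.
have [N NP] := at_infty_base x1 (sf r _ e40).
exists (Num.max N 1); first by rewrite lt_max ltr01 orbT.
move=> x; rewrite gt_max => /andP[/NP xP _].
apply: (@le_lt_trans _ _ (e / 2)%:E); last by rewrite lte_fin; lra.
apply: ge_ereal_sup => _ [[_ _] [/= [y xy <-] [z xz <-]] <-].
rewrite lee_fin; apply: le_trans (metric_triangle _ (f x) _) _.
rewrite !ballEmdist /= in xy xz.
by have := xP y xy; have := xP z xz; rewrite (metric_sym (f y)); lra.
Qed.

(** * Distance functions and coarse weights *)

Section set_distance.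
Context {R : realType} {X : metricType R}.
Implicit Types (x y z : X) (D : set X).

Definition set_dist D x : R := inf [set mdist x y | y in D].

Lemma set_dist_lbound D x : has_lbound [set mdist x y | y in D].
Proof. by exists 0 => _ [y _ <-]; exact: mdist_ge0. Qed.

Lemma set_dist_ge0 D x : D !=set0 -> 0 <= set_dist D x.
Proof.
move=> [y Dy]; apply: lb_le_inf; first by exists (mdist x y), y.
by move=> _ [z _ <-]; exact: mdist_ge0.
Qed.

Lemma set_dist_le D x y : D y -> set_dist D x <= mdist x y.
Proof. by move=> Dy; apply: ge_inf; [exact: set_dist_lbound|exists y]. Qed.

Lemma set_dist_lt D x (r : R) : D !=set0 -> set_dist D x < r ->
  exists2 y, D y & mdist x y < r.
Proof.
move=> [y Dy] /(@inf_lt _ [set mdist x y | y in D])[|_ [z Dz <-] xz]; last by exists z.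
by exists (mdist x y), y.
Qed.

Lemma set_dist_eq0 D x : D x -> set_dist D x = 0.
Proof.
move=> Dx; apply/eqP; rewrite eq_le set_dist_ge0 ?andbT; last by exists x.
by rewrite -[leRHS](mdistxx x) set_dist_le.
Qed.

Lemma set_dist_lip D x y : D !=set0 -> `|set_dist D x - set_dist D y| <= mdist x y.
Proof.
move=> D0.
suff H u v : set_dist D u - set_dist D v <= mdist u v.
  by rewrite ler_norml; have := H x y; have := H y x; rewrite (metric_sym y x); lra.
rewrite lerBlDl; apply/ler_addgt0Pr => e e0.
have [|z Dz vz] := @set_dist_lt D v (set_dist D v + e) D0; first by lra.
by apply: le_trans (set_dist_le u Dz) _; have := metric_triangle u v z; lra.
Qed.

End set_distance.

Definition coarsely_disjoint {R : realType} {X : metricType R} (x0 : X) {m : nat}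
  (D : 'I_m -> set X) : Prop :=
  forall r : R, \forall x \near at_infty x0,
    ~ forall i, exists2 y, D i y & mdist x y < r.

Section coarse_weights.
Context {R : realType} {X : metricType R} (x0 : X) {m : nat}.
Implicit Types (x y z : X) (D : 'I_m -> set X).

Lemma coarsely_disjoint_near_sub D D' :
  (forall i, \forall x \near at_infty x0, D' i x -> D i x) ->
  coarsely_disjoint x0 D -> coarsely_disjoint x0 D'.
Proof.
move=> D'D cdD r.
have near_sub : \forall x \near at_infty x0, forall i, D' i x -> D i x.
  by apply: filter_forall.
apply: filterS2 (cdD r) (at_infty_ball r near_sub) => x nx xball alli; apply: nx => i.
by have [y Dy xy] := alli i; exists y => //; exact: xball.
Qed.

(** The base point makes the sets nonempty, as the distance functions require, and changes nothing
    far out. *)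
Lemma coarsely_disjointU1 D :
  coarsely_disjoint x0 D -> coarsely_disjoint x0 (fun i => x0 |` D i).
Proof.
apply: coarsely_disjoint_near_sub => i.
by apply: filterS (at_infty_far x0 0) => x xx0 [xE|//]; move: xx0; rewrite xE mdistxx ltxx.
Qed.

Definition dist_sum D x : R := \sum_i set_dist (D i) x.

(* When [D] is coarsely disjoint, the maximum with 1 only matters on a bounded
   set; it makes the weights Lipschitz everywhere. *)
Definition weight D (i : 'I_m) x : R := set_dist (D i) x / Num.max 1 (dist_sum D x).

Variable D : 'I_m -> set X.
Hypothesis D0 : forall i, D i !=set0.

Lemma dist_sum_infty : coarsely_disjoint x0 D ->
  forall M, \forall x \near at_infty x0, M <= dist_sum D x.
Proof.
move=> cdD M; apply: filterS (cdD M) => x nx; rewrite leNgt; apply/negP => sM.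
apply: nx => i; apply: set_dist_lt => //; apply: le_lt_trans sM.
rewrite /dist_sum (bigD1 i)//= lerDl; apply: sumr_ge0 => j _; exact: set_dist_ge0.
Qed.

Lemma weight_ge0 i x : 0 <= weight D i x.
Proof. by rewrite divr_ge0 ?set_dist_ge0// le_max ler01. Qed.

Lemma weight_le1 i x : weight D i x <= 1.
Proof.
rewrite ler_pdivrMr ?lt_max ?ltr01// mul1r le_max; apply/orP; right.
rewrite /dist_sum (bigD1 i)//= lerDl; apply: sumr_ge0 => j _; exact: set_dist_ge0.
Qed.

Lemma weight_eq0 i x : D i x -> weight D i x = 0.
Proof. by move=> Dx; rewrite /weight set_dist_eq0// mul0r. Qed.

Lemma weight_sum x : 1 <= dist_sum D x -> \sum_i weight D i x = 1.
Proof.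
by move=> s1; rewrite -mulr_suml (max_idPr s1) divff// gt_eqF// (lt_le_trans _ s1).
Qed.

(** A quotient estimate: the numerator is 1-Lipschitz, the denominator [m]-Lipschitz and the weight
    at most 1. Keeping the denominator on the left yields slow oscillation, bounding it below by 1 a
    global Lipschitz constant. *)
Lemma weight_lip i x y :
  `|weight D i x - weight D i y| * Num.max 1 (dist_sum D x) <= (m%:R + 1) * mdist x y.
Proof.
set s := Num.max 1 (dist_sum D x); set t := Num.max 1 (dist_sum D y).
have s1 : 1 <= s by rewrite le_max lexx.
have t1 : 1 <= t by rewrite le_max lexx.
have st : `|s - t| <= m%:R * mdist x y.
  apply: (@le_trans _ _ `|dist_sum D x - dist_sum D y|).
    rewrite /s /t; have := ler_norm (dist_sum D x - dist_sum D y).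
    have := ler_norm (- (dist_sum D x - dist_sum D y)); rewrite normrN ler_norml.
    by rewrite /Num.max; do 2 case: ifPn; rewrite -?leNgt; lra.
  rewrite /dist_sum -sumrB; apply: le_trans (ler_norm_sum _ _ _) _.
  rewrite mulr_natl -[in leRHS](card_ord m) -sumr_const; apply: ler_sum => j _.
  exact: set_dist_lip.
have -> : weight D i x - weight D i y =
    (set_dist (D i) x - set_dist (D i) y - weight D i y * (s - t)) / s.
  by rewrite /weight -/s -/t; field; rewrite !gt_eqF//; lra.
rewrite normrM normfV (@ger0_norm _ s) ?divfK ?gt_eqF; [|lra..].
apply: le_trans (ler_normB _ _) _; rewrite normrM mulrDl mul1r addrC; apply: lerD.
  apply: le_trans st; rewrite ger0_norm ?weight_ge0// -[leRHS]mul1r.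
  by apply: ler_wpM2r => //; exact: weight_le1.
exact: set_dist_lip.
Qed.

Lemma weight_slow (A : set X) i : coarsely_disjoint x0 D -> slow_on x0 A (weight D i).
Proof.
move=> cdD; apply: (@slow_on_decay _ _ _ _ _ (fun x => Num.max 1 (dist_sum D x)) (m%:R + 1)).
  by move=> M; apply: filterS (dist_sum_infty cdD M) => x Mx; rewrite le_max Mx orbT.
by move=> x y _ _; exact: weight_lip.
Qed.

End coarse_weights.

(** * Extension of slowly oscillating functions *)

Section slow_extension.
Context {R : realType} {X : metricType R} (x0 : X) (A : set X) (h : X -> R).
Hypothesis slowh : slow_on x0 A h.
Hypothesis h01 : forall a, A a -> 0 <= h a <= 1.

(** [rho] is a scale that tends to infinity along [A] and at which [h] deviates from [h a] by at
    most [1 / rho a]. *)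
Lemma slow_radius : exists rho : X -> R,
  [/\ forall M, \forall a \near at_infty x0, A a -> M <= rho a,
      forall a, rho a * 2 <= mdist x0 a &
      forall a b, A a -> A b -> mdist a b < rho a -> `|h a - h b| * rho a <= 1].
Proof.
pose S a := [set r : R | [/\ 0 <= r, r * 2 <= mdist x0 a &
  forall b, A b -> mdist a b < r -> `|h a - h b| * r <= 1]].
have S0 a : S a 0 by split; rewrite ?mul0r ?mdist_ge0// => b _; rewrite mulr0.
have Sub a : ubound (S a) (mdist x0 a / 2).
  by move=> r [_ ra _]; rewrite ler_pdivlMr.
have supS a : has_sup (S a) by split; [exists 0|exists (mdist x0 a / 2)].
(* The supremum of the admissible radii need not be attained, but if it is positive, its half is
   below some admissible radius. *)
exists (fun a => sup (S a) / 2); split.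
- move=> M; pose M1 := Num.max M 1.
  have M10 : 0 < M1 by rewrite lt_max ltr01 orbT.
  have d0 : 0 < (M1 * 2)^-1 by rewrite invr_gt0; lra.
  apply: filterS2 (slowh (M1 * 2) d0) (at_infty_far x0 (M1 * 4)) => a ha fara Aa.
  apply: (@le_trans _ _ M1); first by rewrite le_max lexx.
  rewrite ler_pdivlMr//; apply: sup_upper_bound => //; split; [lra|lra|].
  move=> b Ab ab; have /ltW := ha b Aa Ab ab.
  by rewrite -[X in _ <= X]div1r ler_pdivlMr//; lra.
- move=> a; rewrite divfK//; apply: le_trans (ge_sup _ (Sub a)) _; first by exists 0.
  by have := mdist_ge0 x0 a; lra.
- move=> a b Aa Ab ab.
  have [s0|s0] := ltP 0 (sup (S a)); last first.
    suff -> : sup (S a) = 0 by rewrite mul0r mulr0.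
    by apply/le_anti; rewrite s0 sup_upper_bound.
  have [r [r0 _ hr] sr] : exists2 r, S a r & sup (S a) / 2 < r.
    by apply: sup_gt; [exists 0|lra].
  apply: le_trans (hr b Ab (lt_trans ab sr)).
  by apply: ler_wpM2l => //; exact: ltW.
Qed.

(* McShane-type extension in which the slope [1 / rho a] of the bump centred at
   [a] tends to 0 at infinity. It agrees with [h] on [A] only asymptotically, so
   it is finally overridden on [A]. *)
Lemma slow_extension : exists F : X -> R,
  [/\ slow_on x0 setT F, forall x, 0 <= F x <= 1 & forall a, A a -> F a = h a].
Proof.
have [rho [rhoinf rhole rhoosc]] := slow_radius.
pose bump x a := h a * Num.max 0 (1 - mdist x a / rho a).
(* The value 0 keeps the set nonempty, and [1 <= rho a] excludes division by zero. *)
pose E x := [set t | t = 0 \/ exists a, [/\ A a, 1 <= rho a & t = bump x a]].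
pose F0 x := sup (E x).
have bump01 x a : A a -> 1 <= rho a -> 0 <= bump x a <= 1.
  move=> Aa rho1; have /andP[h0 h1] := h01 Aa.
  have m0 : 0 <= Num.max 0 (1 - mdist x a / rho a) by rewrite le_max lexx.
  have m1 : Num.max 0 (1 - mdist x a / rho a) <= 1.
    rewrite ge_max ler01 lerBlDr lerDl divr_ge0 ?mdist_ge0//; lra.
  by rewrite mulr_ge0//= mulr_ile1.
have Eub x : ubound (E x) 1.
  by move=> t [->//|[a [Aa rho1 ->]]]; have /andP[] := bump01 x a Aa rho1.
have E0 x : E x !=set0 by exists 0; left.
have supE x : has_sup (E x) by split=> //; exists 1.
have F0_ge0 x : 0 <= F0 x by apply: sup_upper_bound => //; left.
have F0_le1 x : F0 x <= 1 by exact: ge_sup.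
have bump_le x a : A a -> 1 <= rho a -> bump x a <= F0 x.
  by move=> Aa rho1; apply: sup_upper_bound => //; right; exists a.
have bump_eq0 x a : 1 <= rho a -> rho a <= mdist x a -> bump x a = 0.
  move=> rho1 xa; rewrite /bump (_ : Num.max _ _ = 0) ?mulr0//.
  by apply/max_idPl; rewrite subr_le0 ler_pdivlMr ?mul1r//; lra.
(* A bump that is nonzero at [x] has its centre [a] within [rho a], at most half of the distance
   from [a] to [x0]; so [a] is far away as well. *)
have center_far M : \forall x \near at_infty x0, forall a, A a ->
    mdist x a < rho a -> M <= rho a.
  have [N NP] := rhoinf M.
  apply: filterS (at_infty_far x0 (Num.max 0 (N * 2))) => x.
  rewrite gt_max => /andP[x_0 xN] a Aa xa; apply: NP => //.
  have := rhole a; have := metric_triangle x0 a x; rewrite (metric_sym a x); lra.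
have F0_slow r e : 0 < e -> \forall x \near at_infty x0,
    forall y, mdist x y < r -> F0 x <= F0 y + e.
  move=> e0; apply: filterS (center_far (r / e)) => x farx y xy.
  apply: ge_sup => // t [->|[a [Aa rho1 ->]]]; first by have := F0_ge0 y; lra.
  have [xa|xa] := leP (rho a) (mdist x a).
    by rewrite bump_eq0//; have := F0_ge0 y; lra.
  have rhoa := farx a Aa xa; rewrite ler_pdivrMr// in rhoa.
  apply: le_trans (lerD (bump_le y a Aa rho1) (lexx e)).
  have /andP[h0 h1] := h01 Aa.
  rewrite /bump -lerBlDl -mulrBr.
  set u := Num.max _ _; set v := Num.max _ _.
  suff uv : u - v <= e.
    have [uv0|uv0] := leP 0 (u - v); first by apply: le_trans uv; rewrite ler_piMl.
    by apply: le_trans (ltW e0); rewrite mulr_ge0_le0// ltW.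
  have uxy : (1 - mdist x a / rho a) - (1 - mdist y a / rho a) <= e.
    rewrite [leLHS](_ : _ = (mdist y a - mdist x a) / rho a); last by ring.
    rewrite ler_pdivrMr; last by lra.
    have := metric_triangle y x a; rewrite (metric_sym y x); lra.
  have v0 : 0 <= v by rewrite le_max lexx.
  have v1 : 1 - mdist y a / rho a <= v by rewrite le_max lexx orbT.
  rewrite lerBlDr ge_max; lra.
(* The bump centred at [x] gives the lower bound. Any bump that reaches [x] has a centre [a] with
   [h a] within [1 / rho a] of [h x], which gives the upper one. *)
have F0_near e : 0 < e -> \forall x \near at_infty x0,
    A x -> h x <= F0 x <= h x + e.
  move=> e0; apply: filterS2 (rhoinf 1) (center_far e^-1) => x rho1 farx Ax.
  have /andP[hx0 hx1] := h01 Ax.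
  apply/andP; split.
    apply: le_trans (bump_le x x Ax (rho1 Ax)).
    by rewrite /bump mdistxx mul0r subr0 (max_idPr ler01) mulr1.
  apply: ge_sup => // t [->|[a [Aa rhoa1 ->]]]; first lra.
  have [xa|xa] := leP (rho a) (mdist x a); first by rewrite bump_eq0//; lra.
  have rhoa := farx a Aa xa; have ax : mdist a x < rho a by rewrite metric_sym.
  have rhoa0 : 0 < rho a by lra.
  have osc : `|h a - h x| <= e.
    have := rhoosc a x Aa Ax ax; rewrite -ler_pdivlMr// => /le_trans; apply.
    by rewrite div1r -[leRHS]invrK lef_pV2 ?posrE ?invr_gt0.
  have hax : h a <= h x + e by have := ler_norm (h a - h x); lra.
  apply: le_trans hax; rewrite -[leRHS]mulr1; apply: ler_wpM2l.
    by have /andP[] := h01 Aa.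
  by rewrite ge_max ler01 lerBlDr lerDl divr_ge0 ?mdist_ge0//; lra.
pose F x := if `[< A x >] then h x else F0 x.
have FF0 e : 0 < e -> \forall x \near at_infty x0, `|F x - F0 x| <= e.
  move=> e0; apply: filterS (F0_near e e0) => x nearx; rewrite /F.
  case: asboolP => [Ax|_]; last by rewrite subrr normr0 ltW.
  by have /andP[] := nearx Ax; rewrite ler_norml; lra.
exists F; split.
- move=> r e e0; have e40 : 0 < e / 4 by lra.
  apply: filterS3 (filterI (FF0 _ e40) (at_infty_ball r (FF0 _ e40)))
    (F0_slow r _ e40) (at_infty_ball r (F0_slow r _ e40)) => x [Fx Fy] xF yF y _ _ xy.
  have := Fx; have := Fy y xy; have := xF y xy; have yx : mdist y x < r by rewrite metric_sym.
  by have := yF y xy x yx; rewrite !ler_norml ltr_norml; lra.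
- by move=> x; rewrite /F; case: asboolP => [/h01//|_]; rewrite F0_ge0 F0_le1.
- by move=> a Aa; rewrite /F; case: asboolP.
Qed.

End slow_extension.

(** * The swelling property and coordinates on the sphere *)

Definition coarse_swelling {R : realType} {X : metricType R} (x0 : X) (m : nat) : Prop :=
  forall D : 'I_m -> set X, coarsely_disjoint x0 D ->
    exists D' : 'I_m -> set X,
      [/\ coarsely_disjoint x0 D',
          forall i, \forall x \near at_infty x0, D i x -> D' i x &
          \forall x \near at_infty x0, exists i, D' i x].

Lemma ltr_sum_avg {R : realType} (n : nat) (u : 'I_n.+1 -> R) (e : R) :
  (forall i, u i < e / n.+1%:R) -> \sum_i u i < e.
Proof.
move=> ue; have -> : e = \sum_(i < n.+1) (e / n.+1%:R).
  by rewrite sumr_const card_ord -[RHS]mulr_natr divfK.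
by apply: ltr_sum => //; apply/hasP; exists ord0; rewrite ?mem_index_enum.
Qed.

Section simplex_sphere.
Context {R : realType} {n : nat}.
Local Notation sphere := (simplex_sphere R n).

Definition sphere_coord (p : sphere) (i : 'I_n.+2) : R := (set_val p : l1_space R n.+2) i.

Lemma sphere_mdist (p q : sphere) :
  mdist p q = \sum_i `|sphere_coord p i - sphere_coord q i|.
Proof. by []. Qed.

Lemma sphere_coord_dist (p q : sphere) i :
  `|sphere_coord p i - sphere_coord q i| <= mdist p q.
Proof. by rewrite sphere_mdist (bigD1 i)//= lerDl; exact: sumr_ge0. Qed.

Lemma sphere_coord_ge0 (p : sphere) i : 0 <= sphere_coord p i.
Proof. by have [[p0 _] _] := set_valP p; exact: p0. Qed.

Lemma sphere_coord_sum (p : sphere) : \sum_i sphere_coord p i = 1.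
Proof. by have [[_ p1] _] := set_valP p. Qed.

Lemma sphere_coord_le1 (p : sphere) i : sphere_coord p i <= 1.
Proof.
rewrite -(sphere_coord_sum p) (bigD1 i)//= lerDl.
by apply: sumr_ge0 => j _; exact: sphere_coord_ge0.
Qed.

Lemma sphere_coord_eq0 (p : sphere) : exists i, sphere_coord p i = 0.
Proof. by have [_ []] := set_valP p => i pi; exists i. Qed.

Lemma sphere_coord_inj (p q : sphere) : (forall i, sphere_coord p i = sphere_coord q i) -> p = q.
Proof. by move=> pq; apply: val_inj; apply/ffunP. Qed.

Lemma sphere_point (t : 'I_n.+2 -> R) : (forall i, 0 <= t i) -> \sum_i t i = 1 ->
  (exists i, t i = 0) -> exists p : sphere, forall i, sphere_coord p i = t i.
Proof.
move=> t0 t1 [j tj].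
have tP : simplex_boundary R n.+1 [ffun i => t i].
  split; last by exists j; rewrite ffunE.
  by split=> [i|]; [rewrite ffunE|rewrite -t1; apply: eq_bigr => i _; rewrite ffunE].
by exists (SigSub (mem_set tP)) => i; rewrite /sphere_coord /= ffunE.
Qed.

Lemma sphere_inhabited : inhabited sphere.
Proof.
have [|||p _] := @sphere_point (fun i => (i == ord0)%:R); last exact: inhabits p.
- by move=> i.
- by rewrite (bigD1 ord0)//= big1 ?addr0// => i /negbTE ->.
- by exists ord_max.
Qed.

End simplex_sphere.

Section sphere_valued.
Context {R : realType} {X : metricType R} {n : nat} (x0 : X).
Local Notation sphere := (simplex_sphere R n).

Lemma sphere_coord_slow (A : set X) (f : A -> sphere) (h : X -> R) (i : 'I_n.+2) :
  slowly_oscillating f -> (forall a : A, h (set_val a) = sphere_coord (f a) i) ->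
  slow_on x0 A h.
Proof.
move=> sf hf.
have [[a0 _]|A0] := pselect (exists a : A, True); last first.
  move=> r e e0; apply: nearW => x y Ax; exfalso; apply: A0.
  by exists (SigSub (mem_set Ax)).
apply/(_ : slow_on (set_val a0) A h -> _).
  by move=> sh r e e0; apply: (at_infty_base (x0 := set_val a0)); exact: sh.
move=> r e e0; have [N NP] := (slowly_oscillatingP a0 f).1 sf r e e0.
exists N => x Nx y Ax Ay xy.
have := NP (SigSub (mem_set Ax)) Nx (SigSub (mem_set Ay)) xy.
apply: le_lt_trans; apply: le_trans (sphere_coord_dist _ _ i).
by rewrite -!hf.
Qed.

Lemma sphere_slow (A : set X) (f : A -> sphere) (h : 'I_n.+2 -> X -> R) :
  (forall (a : A) i, h i (set_val a) = sphere_coord (f a) i) ->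
  (forall i, slow_on x0 A (h i)) -> slowly_oscillating f.
Proof.
move=> hf sh.
suff sf (a0 : A) : slowly_oscillating f by move=> a; exact: (sf a).
apply/(slowly_oscillatingP a0) => r e e0.
have d0 : 0 < e / n.+2%:R by rewrite divr_gt0.
have : \forall x \near at_infty (set_val a0), forall i, forall y, A x -> A y ->
    mdist x y < r -> `|h i x - h i y| < e / n.+2%:R.
  by apply: filter_forall => i; apply: (at_infty_base (x0 := x0)); exact: sh.
move=> [N NP]; exists N => a Na b ab; rewrite sphere_mdist.
by apply: ltr_sum_avg => i; rewrite -!hf; apply: NP => //; exact: set_valP.
Qed.

Lemma sphere_slowT (f : X -> sphere) :
  (forall i, slow_on x0 setT (fun x => sphere_coord (f x) i)) <-> slowly_oscillating f.
Proof.
split=> [sf|/(slowly_oscillatingP x0) sf i r e e0].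
  apply/(slowly_oscillatingP x0) => r e e0.
  have d0 : 0 < e / n.+2%:R by rewrite divr_gt0.
  have : \forall x \near at_infty x0, forall i, forall y, setT x -> setT y ->
      mdist x y < r -> `|sphere_coord (f x) i - sphere_coord (f y) i| < e / n.+2%:R.
    by apply: filter_forall => i; exact: sf.
  apply: filterS => x fx y xy; rewrite sphere_mdist.
  by apply: ltr_sum_avg => i; exact: fx.
apply: filterS (sf r e e0) => x fx y _ _ xy.
by apply: le_lt_trans (fx y xy); exact: sphere_coord_dist.
Qed.

Lemma extensor_coarse_swelling :
  large_scale_absolute_extensor sphere X -> coarse_swelling x0 n.+2.
Proof.
move=> ext D cdD; pose D1 i := x0 |` D i.
have D10 i : D1 i !=set0 by exists x0; left.
have cdD1 : coarsely_disjoint x0 D1 by exact: coarsely_disjointU1.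
have near1 := dist_sum_infty D10 cdD1 1.
(* On [A] the weights sum to 1 and one of them vanishes, so they define a point of the boundary; far
   out, [A] is the whole union of the [D1 i]. *)
pose A := [set x | (exists i, D1 i x) /\ 1 <= dist_sum D1 x].
have /choice[f fP] : forall a : A, exists p : sphere,
    forall i, sphere_coord p i = weight D1 i (set_val a).
  move=> a; have [[i Di] s1] := set_valP a.
  apply: sphere_point; first by move=> j; exact: weight_ge0.
    exact: weight_sum.
  by exists i; exact: weight_eq0.
have [|g sg gf] := ext A f.
  by apply: (@sphere_slow _ _ (weight D1)) => [//|i]; exact: weight_slow.
exists (fun i => [set x | sphere_coord (g x) i = 0]); split.
- move=> r; have d0 : 0 < n.+2%:R^-1 :> R by rewrite invr_gt0.
  (* If every coordinate of [g] vanishes somewhere within [r] of a far point [x], each is below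
     [1 / n.+2] at [x], although they sum to 1. *)
  apply: filterS ((slowly_oscillatingP x0 g).1 sg r _ d0) => x gx all0.
  have : \sum_i sphere_coord (g x) i < 1.
    apply: ltr_sum_avg => i; rewrite div1r; have [y /= y0 xy] := all0 i.
    apply: le_lt_trans (gx y xy); apply: le_trans (sphere_coord_dist _ _ i).
    by rewrite y0 subr0 ler_norm.
  by rewrite sphere_coord_sum ltxx.
- move=> i; apply: filterS near1 => x s1 Dx /=.
  have Ax : A x by split=> //; exists i; right.
  rewrite -[x]/(set_val (SigSub (mem_set Ax) : A)) gf fP weight_eq0//; first by right.
- by apply: nearW => x; exact: sphere_coord_eq0.
Qed.

End sphere_valued.

(** * Pushing points to the boundary of the simplex *)

Section coordinate_min.
Context {R : realType} {n : nat}.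
Implicit Types t u : 'I_n.+1 -> R.

Definition vmin t : R := t [arg min_(i < ord0) t i]%O.

Lemma vmin_le t i : vmin t <= t i.
Proof. by rewrite /vmin; case: arg_minP => // j _; apply. Qed.

Lemma vmin_attained t : exists i, vmin t = t i.
Proof. by exists [arg min_(i < ord0) t i]%O. Qed.

Lemma vmin_lip t u : `|vmin t - vmin u| <= \sum_i `|t i - u i|.
Proof.
suff H v w : vmin v - vmin w <= \sum_i `|v i - w i|.
  have := H t u; have := H u t; under eq_bigr do rewrite distrC.
  by rewrite ler_norml; lra.
have [i ->] := vmin_attained w.
apply: (@le_trans _ _ (v i - w i)); first by rewrite lerD2r vmin_le.
by apply: le_trans (ler_norm _) _; rewrite (bigD1 i)//= lerDl; exact: sumr_ge0.
Qed.

(* Subtracting the minimum and rescaling pushes a point with nonnegative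
   coordinates, not all equal, onto the boundary of the simplex. *)
Definition excess t i : R := t i - vmin t.
Definition excess_sum t : R := \sum_i excess t i.

Lemma excess_ge0 t i : 0 <= excess t i.
Proof. by rewrite subr_ge0 vmin_le. Qed.

Lemma excess_sumE t : excess_sum t = \sum_i t i - n.+1%:R * vmin t.
Proof. by rewrite /excess_sum sumrB sumr_const card_ord mulr_natl. Qed.

Lemma excess_lip t u i : `|excess t i - excess u i| <= 2 * \sum_j `|t j - u j|.
Proof.
have -> : excess t i - excess u i = (t i - u i) - (vmin t - vmin u).
  by rewrite /excess; ring.
have := ler_normB (t i - u i) (vmin t - vmin u); have := vmin_lip t u.
have : `|t i - u i| <= \sum_j `|t j - u j|.
  by rewrite (bigD1 i)//= lerDl; exact: sumr_ge0.
lra.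
Qed.

Lemma normalize_lip (t u : 'I_n.+1 -> R) i :
  (forall i, 0 <= t i) -> (forall i, 0 <= u i) ->
  2^-1 <= \sum_j t j -> 2^-1 <= \sum_j u j ->
  `|t i / \sum_j t j - u i / \sum_j u j| <= 4 * \sum_j `|t j - u j|.
Proof.
move=> t0 u0; set a := \sum_j t j; set b := \sum_j u j => a2 b2.
set S := \sum_j _.
have tiS : `|t i - u i| <= S.
  by rewrite /S (bigD1 i)//= lerDl; exact: sumr_ge0.
have abS : `|a - b| <= S by rewrite /a /b -sumrB; exact: ler_norm_sum.
have u1 : 0 <= u i / b <= 1.
  apply/andP; split; first by rewrite divr_ge0//; lra.
  rewrite ler_pdivrMr; last lra.
  by rewrite mul1r /b (bigD1 i)//= lerDl; exact: sumr_ge0.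
have -> : t i / a - u i / b = ((t i - u i) - (u i / b) * (a - b)) / a.
  by field; rewrite !gt_eqF//; lra.
rewrite normrM normfV (@ger0_norm _ a); last lra.
rewrite ler_pdivrMr; last lra.
apply: le_trans (ler_normB _ _) _; rewrite normrM (@ger0_norm _ (u i / b)); last by case/andP: u1.
have : u i / b * `|a - b| <= S.
  by apply: le_trans abS; rewrite ler_piMl//; case/andP: u1.
have S0 : 0 <= S by exact: sumr_ge0.
have : S * 2^-1 <= S * a by exact: ler_wpM2l.
lra.
Qed.

End coordinate_min.

Section slow_algebra.
Context {R : realType} {X : metricType R} (x0 : X) (A : set X).
Implicit Types h k : X -> R.

Lemma slow_onD h k : slow_on x0 A h -> slow_on x0 A k -> slow_on x0 A (h \+ k).
Proof.
move=> sh sk.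
apply: (@slow_on_lipschitz _ _ bool _ _ setT (fun b => if b then h else k) _ 1).
- by case.
- exact: filterT.
- move=> x y _ _ _ _; rewrite mul1r big_bool /=.
  by rewrite (_ : h x + k x - (h y + k y) = (h x - h y) + (k x - k y)) ?ler_normD//; ring.
Qed.

Lemma slow_onN h : slow_on x0 A h -> slow_on x0 A (fun x => - h x).
Proof.
by move=> sh r e e0; apply: filterS (sh r e e0) => x hx y Ax Ay xy; rewrite -opprD normrN hx.
Qed.

Lemma slow_onM h k : (forall x, `|h x| <= 1) -> (forall x, `|k x| <= 1) ->
  slow_on x0 A h -> slow_on x0 A k -> slow_on x0 A (fun x => h x * k x).
Proof.
move=> h1 k1 sh sk.
apply: (@slow_on_lipschitz _ _ bool _ _ setT (fun b => if b then h else k) _ 1).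
- by case.
- exact: filterT.
- move=> x y _ _ _ _; rewrite mul1r big_bool /=.
  rewrite (_ : h x * k x - h y * k y = (h x - h y) * k x + h y * (k x - k y)); last by ring.
  apply: le_trans (ler_normD _ _) _; rewrite !normrM; apply: lerD.
    by rewrite ler_piMr.
  by rewrite ler_piMl.
Qed.

End slow_algebra.

Lemma max0_lip {R : realDomainType} (a b : R) : `|Num.max 0 a - Num.max 0 b| <= `|a - b|.
Proof.
have := ler_norm (a - b); have := ler_norm (- (a - b)); rewrite normrN ler_norml.
by rewrite /Num.max; do 2 case: ifPn; rewrite -?leNgt; lra.
Qed.

(** * From swellings to extensions of sphere-valued maps *)

Section swelling_extensor.
Context {R : realType} {X : metricType R} {n : nat} (x0 : X).
Local Notation sphere := (simplex_sphere R n).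
Local Notation m := n.+2.

(** A point is supplied for every [t], an arbitrary one when the excess is small, so that choice
    yields a map on all of [X]. *)
Lemma excess_point (t : 'I_m -> R) : exists p : sphere,
  2^-1 <= excess_sum t -> forall i, sphere_coord p i = excess t i / excess_sum t.
Proof.
have [t2|t2] := leP 2^-1 (excess_sum t); last first.
  by have [p] := @sphere_inhabited R n; exists p.
have [|||p pt] := @sphere_point R n (fun i => excess t i / excess_sum t); last by exists p.
- by move=> i; rewrite divr_ge0 ?excess_ge0//; lra.
- by rewrite -mulr_suml -/(excess_sum t) divff// gt_eqF//; lra.
- by have [i ti] := vmin_attained t; exists i; rewrite /excess ti subrr mul0r.
Qed.

(* With [F] extending the given map and [g] a map of [X] to the boundary that
   comes from the swelling, [g] and [F] are interpolated: near the boundary they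
   have a common small coordinate, so the interpolation stays away from the
   barycentre and can be pushed onto the boundary. *)
Lemma coarse_swelling_extensor :
  coarse_swelling x0 m -> large_scale_absolute_extensor sphere X.
Proof.
move=> swell A f sf.
pose h i x := oapp (fun a : A => sphere_coord (f a) i) 0 (insub x).
have hE (a : A) i : h i (set_val a) = sphere_coord (f a) i.
  by rewrite /h (valK a).
have hAE x (Ax : A x) i : h i x = sphere_coord (f (SigSub (mem_set Ax))) i.
  by rewrite -hE.
have /choice[F FP] : forall i, exists F : X -> R,
    [/\ slow_on x0 setT F, forall x, 0 <= F x <= 1 & forall a, A a -> F a = h i a].
  move=> i; apply: slow_extension.
    by apply: (@sphere_coord_slow _ _ _ _ _ f _ i).
  by move=> a Aa; rewrite hAE sphere_coord_ge0 sphere_coord_le1.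
have sF i : slow_on x0 setT (F i) by have [] := FP i.
have F0 i x : 0 <= F i x by have [_ /(_ x)/andP[]] := FP i.
have F1 i x : F i x <= 1 by have [_ /(_ x)/andP[]] := FP i.
have FA x (Ax : A x) i : F i x = sphere_coord (f (SigSub (mem_set Ax))) i.
  by have [_ _ ->//] := FP i; exact: hAE.
(* Small enough that [3 * m * d + d < 1], for the coarse disjointness of [D], and that
   [1 - d - m * d] is at least [2^-1], for the excess. *)
pose d : R := (4 * (m%:R + 1))^-1.
have m0 : 0 <= m%:R :> R by [].
have d0 : 0 < d by rewrite invr_gt0; lra.
have dE : (m%:R + 1) * d = 4^-1.
  by rewrite /d; field; rewrite gt_eqF//; lra.
have sum_cst (e : R) : m%:R * e = \sum_(i < m) e.
  by rewrite sumr_const card_ord mulr_natl.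
pose D i := [set x | F i x <= d /\ 1 - d <= \sum_j F j x].
have cdD : coarsely_disjoint x0 D.
  move=> r.
  have : \forall x \near at_infty x0, forall i, forall y, setT x -> setT y ->
      mdist x y < r -> `|F i x - F i y| < d.
    by apply: filter_forall => i; exact: sF.
  apply: filterS => x Fx all0.
  have small i : F i x <= d + d.
    have [y [Fy _] xy] := all0 i; have := Fx i y I I xy.
    by rewrite ltr_norml => /andP[_]; lra.
  have sum_small : \sum_i F i x <= m%:R * (d + d).
    by rewrite sum_cst; apply: ler_sum => i _.
  have [y [_ sumy] xy] := all0 ord0.
  have : \sum_i F i y <= \sum_i F i x + m%:R * d.
    rewrite sum_cst -big_split /=.
    apply: ler_sum => i _; have := Fx i y I I xy.
    by rewrite ltr_norml => /andP[]; lra.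
  lra.
have [D' [cdD' DD' coverD']] := swell D cdD.
(* The union with [D i] makes [E i] contain [D i] everywhere and not only far out, which the case of
   positive [u] below relies on. *)
pose E i := x0 |` (D i `|` D' i).
have E0 i : E i !=set0 by exists x0; left.
have cdE : coarsely_disjoint x0 E.
  apply: coarsely_disjointU1; apply: coarsely_disjoint_near_sub cdD' => i.
  by apply: filterS (DD' i) => x DDx [/DDx|].
pose g := weight E.
have g0 i x : 0 <= g i x by exact: weight_ge0.
have g1 i x : g i x <= 1 by exact: weight_le1.
(* A cut-off that is 1 where [F] lies on the boundary and 0 once the defect of [F], measured by its
   sum and its minimum, reaches [d]. *)
pose u x := Num.max 0 (1 - (`|\sum_i F i x - 1| + vmin (F^~ x)) / d).
have u0 x : 0 <= u x by rewrite le_max lexx.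
have vF0 x : 0 <= vmin (F^~ x) by have [i ->] := vmin_attained (F^~ x).
have u1 x : u x <= 1.
  by rewrite ge_max ler01 lerBlDr lerDl divr_ge0 ?addr_ge0//; lra.
have su : slow_on x0 setT u.
  apply: (@slow_on_lipschitz _ _ _ _ _ setT F _ (2 / d)) => //; first exact: filterT.
  move=> x y _ _ _ _; set S := \sum_i _.
  have vS : `|vmin (F^~ x) - vmin (F^~ y)| <= S by exact: vmin_lip.
  have sS : `|\sum_i F i x - \sum_i F i y| <= S by rewrite -sumrB; exact: ler_norm_sum.
  apply: le_trans (max0_lip _ _) _.
  set a := `|_ - 1|; set b := `|_ - 1|.
  have ab : `|a - b| <= S.
    apply: le_trans (ler_dist_dist _ _) _; apply: le_trans sS.
    by rewrite opprB addrA subrK.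
  rewrite (_ : 1 - _ - _ = ((b - a) + (vmin (F^~ y) - vmin (F^~ x))) / d); last by ring.
  rewrite normrM normfV (ger0_norm (ltW d0)) mulrAC ler_pM2r ?invr_gt0//.
  by apply: le_trans (ler_normD _ _) _; rewrite distrC (distrC (vmin _)); lra.
pose t x i := g i x + u x * (F i x - g i x).
have st i : slow_on x0 setT (fun x => t x i).
  apply: slow_onD; first exact: weight_slow.
  apply: slow_onM => //; first by move=> x; rewrite ger0_norm.
    move=> x; have := F0 i x; have := F1 i x; have := g0 i x; have := g1 i x.
    by rewrite ler_norml; lra.
  by apply: slow_onD => //; apply: slow_onN; exact: weight_slow.
pose B := [set x | 1 <= dist_sum E x /\ exists i, E i x].
have nearB : \forall x \near at_infty x0, B x.
  apply: filterS2 (dist_sum_infty E0 cdE 1) coverD' => x s1 [i Di]; split=> //.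
  by exists i; right; right.
have excess_big x : B x -> 2^-1 <= excess_sum (t x).
  move=> [s1 [i Ei]].
  have gsum : \sum_j g j x = 1 by exact: weight_sum.
  have tsum : \sum_j t x j = 1 + u x * (\sum_j F j x - 1).
    by rewrite /t big_split /= -mulr_sumr sumrB gsum.
  rewrite excess_sumE tsum.
  (* If [u x = 0], then [t x] consists of the weights, and its coordinate [i] vanishes. Otherwise
     the smallest coordinate [j] of [F] satisfies [D j x], so [g j x = 0] and [t x j <= d]. *)
  have [ux|ux] := ltP 0 (u x); last first.
    have ux0 : u x = 0 by apply/le_anti; rewrite ux u0.
    have : vmin (t x) <= 0.
      by apply: le_trans (vmin_le _ i) _; rewrite /t ux0 /g weight_eq0// mul0r addr0.
    rewrite ux0 mul0r addr0; have := m0; nra.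
  have small : `|\sum_j F j x - 1| + vmin (F^~ x) < d.
    by move: ux; rewrite lt_max ltxx /= subr_gt0 ltr_pdivrMr// mul1r.
  have := vF0 x; have := ler_norm (- (\sum_j F j x - 1)); rewrite normrN => ns vF.
  have [j vj] := vmin_attained (F^~ x).
  have Dj : D j x.
    by split; [rewrite -vj|]; have := normr_ge0 (\sum_j F j x - 1); lra.
  have gj : g j x = 0 by apply: weight_eq0; right; left.
  have vt : vmin (t x) <= d.
    apply: le_trans (vmin_le _ j) _; rewrite /t gj add0r subr0.
    by apply: le_trans (_ : F j x <= _); [rewrite ler_piMl|case: Dj].
  have : - d <= u x * (\sum_j F j x - 1).
    have : u x * (- (\sum_j F j x - 1)) <= u x * d by rewrite ler_wpM2l//; lra.
    have : u x * d <= 1 * d by rewrite ler_wpM2r//; lra.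
    by rewrite mulrN; lra.
  have : m%:R * vmin (t x) <= m%:R * d by exact: ler_wpM2l.
  lra.
have /choice[out outP] := fun x => excess_point (t x).
exists out.
  apply/(sphere_slowT x0) => i.
  apply: (@slow_on_lipschitz _ _ _ _ _ B (fun j x => excess (t x) j) _ 4) => //.
    move=> j; apply: (@slow_on_lipschitz _ _ _ _ _ setT (fun j x => t x j) _ 2) => //.
      exact: filterT.
    by move=> x y _ _ _ _; exact: excess_lip.
  move=> x y _ _ Bx By; rewrite !outP; [|exact: excess_big..].
  by apply: normalize_lip; [exact: excess_ge0|exact: excess_ge0|exact: excess_big..].
move=> a; apply: sphere_coord_inj => i.
have Aa := set_valP a.
have aE : SigSub (mem_set Aa) = a by exact: val_inj.
have Fa j : F j (set_val a) = sphere_coord (f a) j by rewrite FA aE.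
(* On [A] the values of [F] lie on the boundary, so [u] is 1, [t] equals [F], and pushing to the
   boundary changes nothing. *)
have vF : vmin (F^~ (set_val a)) = 0.
  apply/le_anti; rewrite vF0 andbT.
  have [j fj] := sphere_coord_eq0 (f a).
  by apply: le_trans (vmin_le _ j) _; rewrite Fa fj.
have sF1 : \sum_j F j (set_val a) = 1.
  by rewrite (eq_bigr _ (fun j _ => Fa j)) sphere_coord_sum.
have ua : u (set_val a) = 1.
  by rewrite /u vF sF1 subrr normr0 addr0 mul0r subr0 (max_idPr ler01).
have ta : t (set_val a) = F^~ (set_val a).
  by apply/funext => j; rewrite /t ua mul1r addrC subrK.
have ea : excess_sum (t (set_val a)) = 1.
  by rewrite excess_sumE ta vF sF1 mulr0 subr0.
rewrite outP ea; last lra.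
by rewrite divr1 /excess ta vF subr0 Fa.
Qed.

End swelling_extensor.

(** * The Higson cube and limit points in the corona *)

Lemma compact_unit_interval (R : realType) : compact [set: unit_interval R].
Proof.
have clipP (x : R) : unit_interval R (Num.min 1 (Num.max 0 x) : R^o).
  by rewrite /unit_interval /= le_min ler01 le_max lexx /= ge_min lexx.
pose clip (x : R) : unit_interval R := SigSub (mem_set (clipP x)).
have -> : [set: unit_interval R] = clip @` `[0, 1]%classic.
  apply/seteqP; split=> // t _; have /andP[t0 t1] := set_valP t.
  exists (set_val t : R); first by rewrite /= in_itv /= t0.
  by apply: val_inj; rewrite /= (max_idPr t0) (min_idPr t1).
apply: continuous_compact; last exact: segment_compact.
apply: continuous_subspaceT => x.
apply/metricType_numDomainType.cvgrPdist_lt => e e0.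
near=> y.
have : `|x - y| < e by near: y; exact: (@cvgr_dist_lt _ R^o).
apply: le_lt_trans.
change (`|Num.min 1 (Num.max 0 y) - Num.min 1 (Num.max 0 x)| <= `|x - y|).
have := ler_norm (x - y); have := ler_norm (- (x - y)); rewrite normrN ler_norml.
by rewrite /Num.max /Num.min; do 4 case: ifPn; rewrite -?leNgt; lra.
Unshelve. all: by end_near.
Qed.

Section higson_cube.
Context {R : realType} {X : metricType R}.
Local Notation cube := (higson_cube X).
Local Notation eval := (@higson_eval R X).

Lemma compact_higson_cube : compact [set: cube].
Proof.
have := @tychonoff {classic (higson_functions X)} (fun _ => unit_interval R)
  (fun _ => setT) (fun _ => @compact_unit_interval R).
by congr (@compact _ _); apply/seteqP.
Qed.

Lemma hausdorff_higson_cube : hausdorff_space cube.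
Proof.
apply: (@hausdorff_product {classic (higson_functions X)} (fun _ => unit_interval R)) => _.
exact: metric_hausdorff.
Qed.

Lemma normal_higson_cube : normal_space cube.
Proof. exact: compact_normal hausdorff_higson_cube compact_higson_cube. Qed.

Definition coordinate (p : cube) (f : higson_functions X) : R := set_val (p f).

Lemma coordinate_near (p : cube) f (e : R) : 0 < e ->
  \forall q \near p, `|coordinate p f - coordinate q f| < e.
Proof.
move=> e0.
have near_pf := @proj_continuous {classic (higson_functions X)} (fun _ => unit_interval R) f p
  _ (nbhsx_ballx (p f) _ e0).
apply: (@filterS _ (nbhs p) _ _ _ _ near_pf) => q; rewrite /preimage /= ballEmdist /=.
by rewrite distrC.
Qed.

Lemma continuous_higson_eval : continuous eval.
Proof.
move=> x; apply/cvg_sup => f W /= [_ [[V oV <-] Vx] VW].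
have [cf _] := set_valP f.
have : nbhs x (set_val f @^-1` V) by apply: cf; exact: open_nbhs_nbhs.
by apply: filterS => y; exact: VW.
Qed.

Variable x0 : X.

Lemma higson_function_of (h : X -> R) (C : R) :
  (forall x, 0 <= h x <= 1) -> (forall x y, `|h x - h y| <= C * mdist x y) ->
  slow_on x0 setT h ->
  exists f : higson_functions X, forall x, coordinate (eval x) f = h x.
Proof.
move=> h01 hlip sh.
pose k x : unit_interval R := SigSub (mem_set (h01 x : unit_interval R (h x : R^o))).
have kdist x y : mdist (k x) (k y) = `|h x - h y| by exact: distrC.
have kP : higson_functions X k.
  split; last first.
    by apply/(slowly_oscillatingP x0) => r e e0; apply: filterS (sh r e e0) => x hx y xy;
      rewrite kdist; exact: hx.
  move=> x; apply/metricType_numDomainType.cvgrPdist_lt => e e0.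
  have C0 : 0 < `|C| + 1 by have := normr_ge0 C; lra.
  have d0 : 0 < e / (`|C| + 1) by rewrite divr_gt0.
  near=> y.
  have xy : mdist x y < e / (`|C| + 1).
    near: y; have := nbhsx_ballx x _ d0; apply: filterS => y.
    by rewrite ballEmdist.
  rewrite kdist; apply: le_lt_trans (hlip x y) _.
  rewrite ltr_pdivlMr// mulrC in xy; apply: le_lt_trans xy.
  by apply: ler_wpM2r; [exact: mdist_ge0|have := ler_norm C; lra].
by exists (SigSub (mem_set kP)).
Unshelve. all: by end_near.
Qed.

Lemma coordinate_slow (f : higson_functions X) (r e : R) : 0 < e ->
  \forall x \near at_infty x0, forall y, mdist x y < r ->
    mdist (eval x f) (eval y f) < e.
Proof. by move=> e0; have [_ /(slowly_oscillatingP x0) sf] := set_valP f; exact: sf. Qed.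

Definition lim_at_infty (B : set X) : set cube := limit_set (at_infty x0) eval B.

(** By properness, a point of the closure outside the image has a neighbourhood that misses the
    compact image of any given ball, so it is approached by far points. Conversely, a Lipschitz bump
    at [x1] separates the image of [x1] from far points. *)
Lemma higson_corona_lim : proper_metric X -> higson_corona X = lim_at_infty setT.
Proof.
move=> properX; apply/seteqP; split=> p.
  move=> [clp nrp]; apply/limit_setP => A W [N NA] pW.
  pose K := closure (ball x0 (N + 1)).
  have cptK : compact K.
    apply: properX; apply: (@le_lt_trans _ _ ((N + 1) * 2)%:E); last by rewrite ltry.
    apply: ge_ereal_sup => _ [[y z] [/= yB zB] <-]; rewrite lee_fin.
    rewrite !ballEmdist /= in yB zB.
    by have := metric_triangle y x0 z; rewrite (metric_sym y x0); lra.
  have clK : closed (eval @` K).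
    apply: compact_closed; first exact: hausdorff_higson_cube.
    apply: continuous_compact => //.
    exact: continuous_subspaceT continuous_higson_eval.
  have pK : nbhs p (~` (eval @` K)).
    apply: open_nbhs_nbhs; split; first exact: closed_openC.
    by move=> [x _ xp]; apply: nrp; exists x.
  have [_ [[x _ <-] [Wx nKx]]] := clp _ (filterI pW pK).
  exists x; split=> //; apply: NA; rewrite ltNge; apply/negP => xN; apply: nKx.
  by exists x => //; apply: subset_closure; rewrite ballEmdist /=; lra.
move=> /limit_setP clp; split.
  by move=> W pW; have [x [_ _ Wx]] := clp _ _ filterT pW; exists (eval x); split=> //; exists x.
move=> [x1 _ x1p].
pose b x := Num.max 0 (1 - mdist x1 x).
have b0 x : 1 <= mdist x1 x -> b x = 0.
  by move=> xx1; apply/max_idPl; lra.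
have [|||f fb] := @higson_function_of b 1.
- move=> x; rewrite /b le_max lexx /= ge_max ler01 /=; have := mdist_ge0 x1 x; lra.
- move=> x y; apply: le_trans (max0_lip _ _) _; rewrite mul1r.
  have := metric_triangle x1 x y; have := metric_triangle x1 y x.
  by rewrite (metric_sym y x) ler_norml; lra.
- move=> r e e0.
  have far : \forall x \near at_infty x0, 1 <= mdist x1 x.
    by apply: at_infty_base; apply: filterS (at_infty_far x1 1) => x /ltW.
  apply: filterS2 far (at_infty_ball r far) => x x1x xy y _ _ xyr.
  by rewrite b0// b0 ?subrr ?normr0//; exact: xy.
have far : \forall x \near at_infty x0, 1 <= mdist x1 x.
  by apply: at_infty_base; apply: filterS (at_infty_far x1 1) => x /ltW.
have [x [x1x _]] := clp _ _ far (@coordinate_near p f 1 ltr01).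
by rewrite -x1p !fb (b0 x)// /b mdistxx !subr0 (max_idPr ler01) normr1 ltxx.
Qed.

(** The weights are coordinates of the cube. At a common limit point they would all vanish, whereas
    near it there are far points of [X] at which they sum to 1. *)
Lemma coarsely_disjoint_lim (m : nat) (D : 'I_m.+1 -> set X) (p : cube) :
  coarsely_disjoint x0 D -> ~ forall i, lim_at_infty (D i) p.
Proof.
move=> cdD limD; pose E i := x0 |` D i.
have E0 i : E i !=set0 by exists x0; left.
have cdE : coarsely_disjoint x0 E by exact: coarsely_disjointU1.
have /choice[f fP] : forall i, exists f : higson_functions X,
    forall x, coordinate (eval x) f = weight E i x.
  move=> i; apply: (@higson_function_of _ (m.+1%:R + 1)).
  - by move=> x; rewrite weight_ge0// weight_le1.
  - move=> x y; apply: le_trans (weight_lip E0 i x y).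
    by rewrite ler_peMr// le_max lexx.
  - exact: weight_slow.
have d0 : 0 < (m.+1%:R)^-1 / 2 :> R by rewrite divr_gt0// invr_gt0.
have small i : coordinate p (f i) < m.+1%:R^-1 / 2.
  have /limit_setP/(_ _ _ filterT (coordinate_near p (f i) d0))[x [_ Dx]] := limD i.
  rewrite fP weight_eq0 ?subr0; last by right.
  exact: le_lt_trans (ler_norm _).
have near_p : \forall q \near p, forall i, `|coordinate p (f i) - coordinate q (f i)| < m.+1%:R^-1 / 2.
  by apply: (@filter_forall _ _ _ (nbhs p)) => i; exact: coordinate_near.
have /limit_setP/(_ _ _ (dist_sum_infty E0 cdE 1) near_p)[x [s1 _ xp]] := limD ord0.
have := weight_sum s1; suff : \sum_i weight E i x < 1 by move=> /[swap] ->; rewrite ltxx.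
apply: ltr_sum_avg => i; rewrite div1r.
have := xp i; have := small i; rewrite fP ltr_norml; set v := m.+1%:R^-1.
by move=> ? /andP[]; lra.
Qed.

(** If the [r]-neighbourhoods met in an unbounded set [Q], compactness would give a limit point of
    [Q]. Moving [Q] into [D i] by less than [r] keeps it, because the coordinates oscillate
    slowly. *)
Lemma lim_coarsely_disjoint (m : nat) (D : 'I_m -> set X) :
  (forall p, ~ forall i, lim_at_infty (D i) p) -> coarsely_disjoint x0 D.
Proof.
move=> limD r; pose Q := [set x | forall i, exists2 y, D i y & mdist x y < r].
apply: contrapT => nQ.
have [p limQ] := limit_set_nonempty eval compact_higson_cube nQ.
apply: (limD p) => i.
have /choice[tau tauP] : forall x, exists y,
    (Q x -> D i y /\ mdist x y < r) /\ (~ Q x -> y = x).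
  move=> x; have [Qx|nQx] := pselect (Q x); last by exists x.
  by have [y Dy xy] := Qx i; exists y.
apply: (limit_set_perturb (tau := tau) _ _ _ limQ).
- move=> A FA; apply: filterS2 FA (at_infty_ball r FA) => x Ax xA.
  have [Qx|nQx] := pselect (Q x).
    by have [/(_ Qx)[_ xy] _] := tauP x; exact: xA.
  by have [_ /(_ nQx)] := tauP x; rewrite /preimage /= => ->.
- by move=> x Qx; have [/(_ Qx)[]] := tauP x.
- move=> f e e0; apply: filterS (coordinate_slow f r e0) => x xf Qx.
  by apply: xf; have [/(_ Qx)[]] := tauP x.
Qed.

End higson_cube.

(** * Covers of the corona and swellings *)

Section corona_dimension.
Context {R : realType} {X : metricType R} (x0 : X).
Hypothesis properX : proper_metric X.
Local Notation corona := (set_type (higson_corona X)).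
Local Notation eval := (@higson_eval R X).
Local Notation lim := (lim_at_infty x0).

Let in_lim (q : corona) : lim setT (set_val q).
Proof. by rewrite -(higson_corona_lim x0 properX); exact: set_valP. Qed.

Let lim_corona (B : set X) (p : higson_cube X) : lim B p -> higson_corona X p.
Proof.
by rewrite (higson_corona_lim x0 properX); apply: limit_set_near_sub; apply: nearW.
Qed.

(** The complements of the limit sets of [D] cover the corona. For a shrinking [V], the closed
    complements have empty intersection because [V] is a cover, and they cover the corona because no
    point lies in every [V i]. Thickened in the cube, they induce the swelling on [X]. *)
Lemma shrinkable_covers_swelling (m : nat) :
  shrinkable_covers corona m.+1 -> coarse_swelling x0 m.+1.
Proof.
move=> shr D cdD.
have [||V [oV VD coverV V0]] := shr (fun i => ~` (set_val @^-1` lim (D i))).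
- move=> i; exists (~` lim (D i)) => //.
  by apply: closed_openC; exact: limit_set_closed.
- move=> q; apply: contrapT => /forallNP nq.
  by apply: (coarsely_disjoint_lim (p := set_val q) cdD) => i; exact: contrapT (nq i).
have /choice[W WP] : forall i, exists W : set (higson_cube X),
    open W /\ set_val @^-1` W = V i.
  by move=> i; have [W oO OV] := oV i; exists W.
have inV (q : corona) i : W i (set_val q) <-> V i q by have [_ <-] := WP i.
pose K i := ~` W i `&` lim setT.
have [||N [cN KN N0]] := closed_thickening (E := K) (@normal_higson_cube R X).
- move=> i; apply: closedI; last exact: limit_set_closed.
  by apply: open_closedC; have [] := WP i.
- move=> p allp; have [_ limp] := allp ord0.
  have [i /inV Oi] := coverV (SigSub (mem_set (lim_corona limp))).
  by have [nO _] := allp i; exact: nO.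
have limDK i : lim (D i) `<=` K i.
  move=> p limp; split; last first.
    by have := lim_corona limp; rewrite (higson_corona_lim x0 properX).
  pose q : corona := SigSub (mem_set (lim_corona limp)).
  by move=> Op; have /VD : V i q by exact/inV.
exists (fun i => eval @^-1` N i); split.
- apply: lim_coarsely_disjoint => p limp; apply: (N0 p) => i.
  exact: (limit_set_preimage (cN i)) (limp i).
- move=> i; apply: limit_set_near_preimage (@compact_higson_cube R X) _.
  exact: subset_trans (limDK i) (KN i).
- have : \forall x \near at_infty x0, setT x -> (\bigcup_i N i) (eval x).
    apply: limit_set_near_preimage (@compact_higson_cube R X) _ => p limp.
    have limp' : higson_corona X p by exact: lim_corona limp.
    have [i nV] : exists i, ~ V i (SigSub (mem_set limp')).
      by apply/existsNP => allV; exact: V0 allV.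
    have : (N i)° p by apply: KN; split=> // Op; apply: nV; exact/inV.
    by apply: (@filterS _ (nbhs p)) => y Ny; exists i.
  by apply: filterS => x /(_ I)[i _ Ni]; exists i.
Qed.

(** Thickened complements of the [U i] induce a coarsely disjoint family on [X]. The complements of
    the limit sets of its swelling form the shrinking: coarse disjointness makes them a cover, the
    covering property makes their intersection empty. *)
Lemma swelling_shrinkable_covers (m : nat) :
  coarse_swelling x0 m.+1 -> shrinkable_covers corona m.+1.
Proof.
move=> swell U oU coverU.
have /choice[W WP] : forall i, exists W : set (higson_cube X),
    open W /\ set_val @^-1` W = U i.
  by move=> i; have [W oO OU] := oU i; exists W.
have inU (q : corona) i : W i (set_val q) <-> U i q by have [_ <-] := WP i.
pose E i := ~` W i `&` lim setT.
have [||N [cN EN N0]] := closed_thickening (E := E) (@normal_higson_cube R X).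
- move=> i; apply: closedI; last exact: limit_set_closed.
  by apply: open_closedC; have [] := WP i.
- move=> p allp; have [_ limp] := allp ord0.
  have [i /inU Oi] := coverU (SigSub (mem_set (lim_corona limp))).
  by have [nO _] := allp i; exact: nO.
have [|D' [cdD' DD' coverD']] := swell (fun i => eval @^-1` N i).
  apply: lim_coarsely_disjoint => p limp; apply: (N0 p) => i.
  exact: (limit_set_preimage (cN i)) (limp i).
exists (fun i => ~` (set_val @^-1` lim (D' i))); split.
- move=> i; exists (~` lim (D' i)) => //.
  by apply: closed_openC; exact: limit_set_closed.
- move=> i q /= nlim; apply: contrapT => nU; apply: nlim.
  (* The thickening makes [q] an interior point of [N i], hence a limit point of the trace of [N i]
     on [X]. *)
  have qN : nbhs (set_val q) (N i) by apply: EN; split=> // /inU.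
  apply: (limit_set_near_sub (DD' i)).
  exact: (@limit_set_nbhs _ _ _ _ eval _ _ (@in_lim q) qN).
- move=> q; apply: contrapT => /forallNP nq.
  by apply: (coarsely_disjoint_lim (p := set_val q) cdD') => i; exact: contrapT (nq i).
- by move=> q allq; have [i] := limit_set_cover coverD' (@in_lim q); exact: allq.
Qed.

End corona_dimension.

Theorem corollary7p2 (R : realType) (X : metricType R) (n : nat)
    (properX : proper_metric X) :
  covering_dim_le (set_type (higson_corona X)) n <->
  large_scale_absolute_extensor (simplex_sphere R n) X.
Proof.
(* [coarse_swelling] needs a base point; for the empty space both conditions hold trivially. *)
have [[x0 _]|X0] := pselect (exists x : X, True).
  split=> [/covering_dim_shrinkable/(shrinkable_covers_swelling (x0 := x0) properX)|].
    exact: coarse_swelling_extensor.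
  move=> /(extensor_coarse_swelling (x0 := x0))/(swelling_shrinkable_covers properX).
  exact: shrinkable_covering_dim.
have noX (x : X) : False by apply: X0; exists x.
split=> [_ A f _|_ U _ _ _].
  by exists (fun x => False_rect _ (noX x)) => [x0|a]; [case: (noX x0)|case: (noX (set_val a))].
have noq (q : set_type (higson_corona X)) : False.
  by have [clq _] := set_valP q; have [_ [[x _ _] _]] := clq _ filterT; exact: noX x.
exists set0; split=> //; first by apply/seteqP; split=> // q; case: (noq q).
Qed.
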